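(* Let $X$ be a Banach space with normed dual $Y$, let $x\in X$ and $\alpha\in Y$ with $\alpha(x)=1$, and let $\mathcal{A}\subset B(X)$ be a maximal abelian subalgebra of $B(X)$. Then $\mathcal{A}$ is a maximal $x\otimes\alpha$-tracial algebra in $B(X)$ if and only if $[\mathcal{A}x]^{-\|\cdot\|}=X$ and $[\mathcal{A}^{\#}\alpha]^{-\text{weak*}}=Y$.
   Context: $B(X)$ is the algebra of bounded linear operators on $X$, and for $T\in B(X)$, $T^{\#}\in B(Y)$ is the Banach-space adjoint, $(T^{\#}\beta)(z)=\beta(Tz)$; $\mathcal{A}^{\#}=\{A^{\#}:A\in\mathcal{A}\}$. The functional $x\otimes\alpha$ on $B(X)$ is given by $(x\otimes\alpha)(T)=\alpha(Tx)$. $[\mathcal{A}x]^{-\|\cdot\|}$ is the norm closure of $\{Ax:A\in\mathcal{A}\}$ in $X$ and $[\mathcal{A}^{\#}\alpha]^{-\text{weak*}}$ is the weak*-closure of $\{A^{\#}\alpha:A\in\mathcal{A}\}$ in $Y$. A subalgebra is maximal abelian if it is abelian and not properly contained in another abelian subalgebra. If $\mathcal{B}$ is a unital algebra and $\varphi$ is a linear functional on $\mathcal{B}$ with $\varphi(1)=1$, a subalgebra $\mathcal{A}$ of $\mathcal{B}$ with $1\in\mathcal{A}$ is $\varphi$-tracial if $\varphi(ab)=\varphi(ba)$ for all $a,b\in\mathcal{A}$; it is maximal $\varphi$-tracial in $\mathcal{B}$ if it is $\varphi$-tracial and no strictly larger subalgebra of $\mathcal{B}$ is $\varphi$-tracial.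 *)

(* Defs.v *)
From HB Require Import structures.
From mathcomp Require Import all_boot all_order all_algebra.
From mathcomp Require Import complex.
From mathcomp Require Import all_classical all_reals all_analysis.

Set Implicit Arguments.
Unset Strict Implicit.
Unset Printing Implicit Defensive.

Import Order.TTheory GRing.Theory Num.Theory.
Import numFieldNormedType.Exports.
Local Open Scope classical_set_scope.
Local Open Scope ring_scope.

(* A Banach space is a complete normed space over the real or the complex
   numbers. *)
Variant scalar_kind := RealScalars | ComplexScalars.

Definition scalar_field (R : realType) (k : scalar_kind) : numFieldType :=
  match k with
  | RealScalars => R
  | ComplexScalars => R[i]
  end.

Section BoundedLinearMaps.
Variables (K : numFieldType) (V W : normedModType K).

Definition bounded_linear_map : {pred V -> W} := fun f =>
  `[< linear f /\ exists M : K, forall v, `|f v| <= M * `|v| >].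

Record blin := BLin {
  blin_fun :> V -> W;
  _ : blin_fun \in bounded_linear_map
}.

HB.instance Definition _ := [isSub for blin_fun].
HB.instance Definition _ := [Choice of blin by <:].

Lemma bounded_linear_map_submod : submod_closed bounded_linear_map.
Proof.
split=> [|c f g].
  apply/asboolP; split=> [c u v|].
    by rewrite /GRing.zero/= scaler0 addr0.
  by exists 0 => v; rewrite /GRing.zero/= normr0 mul0r.
move=> /asboolP[lf [M Mf]] /asboolP[lg [N Ng]]; apply/asboolP; split.
  move=> d u v; rewrite !fctE lf lg scalerDr scalerDr !scalerA.
  by rewrite [c * d]mulrC addrACA.
exists (`|c| * M + N) => v; rewrite !fctE.
rewrite (le_trans (ler_normD _ _))// mulrDl lerD// normrZ -mulrA.
by rewrite ler_wpM2l.
Qed.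

HB.instance Definition _ := GRing.isSubmodClosed.Build K (V -> W)
  bounded_linear_map bounded_linear_map_submod.
HB.instance Definition _ := [SubChoice_isSubLmodule of blin by <:].

Lemma blin_linear (f : blin) : linear f.
Proof. by case: f => f /= /asboolP[]. Qed.

HB.instance Definition _ (f : blin) :=
  GRing.isLinear.Build K V W *:%R (blin_fun f) (@blin_linear f).

Lemma blin_bounded (f : blin) : exists M : K, forall v, `|f v| <= M * `|v|.
Proof. by case: f => f /= /asboolP[]. Qed.

Lemma blinP (f g : blin) : f =1 g -> f = g.
Proof. by move=> fg; apply/val_inj/funext. Qed.

Lemma blinDE (f g : blin) v : (f + g) v = f v + g v. Proof. by []. Qed.

Lemma blinZE c (f : blin) v : (c *: f) v = c *: f v. Proof. by []. Qed.

End BoundedLinearMaps.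

Section Composition.
Variables (K : numFieldType) (U V W : normedModType K).

Lemma bounded_linear_map_comp (g : blin V W) (f : blin U V) :
  (g \o f : U -> W) \in @bounded_linear_map K U W.
Proof.
apply/asboolP; split=> [c u v|]; first by rewrite /= !linearP.
have [M gM] := blin_bounded g; have [N fN] := blin_bounded f.
exists (`|M| * N) => u /=; rewrite -mulrA (le_trans (gM _))//.
have [->|fu0] := eqVneq (f u) 0.
  by rewrite normr0 mulr0 mulr_ge0// (le_trans _ (fN u)).
have M0 : 0 <= M.
  have := le_trans (normr_ge0 _) (gM (f u)).
  by rewrite pmulr_lge0// normr_gt0.
by rewrite (ger0_norm M0) ler_wpM2l.
Qed.

Definition blin_comp (g : blin V W) (f : blin U V) : blin U W :=
  BLin (bounded_linear_map_comp g f).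

End Composition.

Section BoundedOperators.
Variables (K : numFieldType) (X : normedModType K).

Lemma bounded_linear_map_id : (idfun : X -> X) \in @bounded_linear_map K X X.
Proof. by apply/asboolP; split=> //; exists 1 => v; rewrite mul1r. Qed.

Definition bop := blin X X.

HB.instance Definition _ := SubChoice.on bop.
HB.instance Definition _ := GRing.Lmodule.on bop.

Definition bop_one : bop := BLin bounded_linear_map_id.
Definition bop_mul (S T : bop) : bop := blin_comp S T.

Let bop_mulA : associative bop_mul.
Proof. by move=> S T U; exact: blinP. Qed.
Let bop_mul1l : left_id bop_one bop_mul.
Proof. by move=> S; exact: blinP. Qed.
Let bop_mul1r : right_id bop_one bop_mul.
Proof. by move=> S; exact: blinP. Qed.
Let bop_mulDl : left_distributive bop_mul +%R.
Proof. by move=> S T U; exact: blinP. Qed.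
Let bop_mulDr : right_distributive bop_mul +%R.
Proof. by move=> S T U; apply: blinP => v; exact: (linearD S). Qed.

HB.instance Definition _ := GRing.Zmodule_isPzRing.Build bop
  bop_mulA bop_mul1l bop_mul1r bop_mulDl bop_mulDr.

Lemma bop_scalerAl (c : K) (S T : bop) : c *: (S * T) = (c *: S) * T.
Proof. exact: blinP. Qed.
Lemma bop_scalerAr (c : K) (S T : bop) : c *: (S * T) = S * (c *: T).
Proof. by apply: blinP => v; exact/esym/(linearZ_LR S). Qed.

Lemma bopME (S T : bop) v : (S * T) v = S (T v). Proof. by []. Qed.

Lemma bop1E v : (1 : bop) v = v. Proof. by []. Qed.

End BoundedOperators.

Section Subalgebras.
Variables (K : numFieldType) (X : normedModType K).
Implicit Types (A : set (bop X)) (phi : {scalar bop X}).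

(* A subalgebra need not contain 1. *)
Definition subalgebra A :=
  [/\ A 0,
      forall a b, A a -> A b -> A (a + b),
      forall c a, A a -> A (c *: a)
    & forall a b, A a -> A b -> A (a * b)].

Definition abelian_subalgebra A :=
  subalgebra A /\ forall a b, A a -> A b -> a * b = b * a.

Definition maximal_abelian A :=
  abelian_subalgebra A /\
  forall C : set (bop X), abelian_subalgebra C -> A `<=` C -> C = A.

Definition tracial phi A :=
  [/\ subalgebra A, A 1 & forall a b, A a -> A b -> phi (a * b) = phi (b * a)].

Definition maximal_tracial phi A :=
  tracial phi A /\ forall C : set (bop X), tracial phi C -> A `<=` C -> C = A.

End Subalgebras.

Section Dual.
Variables (K : numFieldType) (X : normedModType K).

Definition dual := blin X K^o.

HB.instance Definition _ := SubChoice.on dual.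
HB.instance Definition _ := GRing.Lmodule.on dual.

(* The weak* topology: the coarsest one making every evaluation
   f |-> f z, z in X, continuous. *)
Definition weak_star :=
  initial_topology (fun f : dual => (f : X -> K^o) : {ptws X -> K^o}).

HB.instance Definition _ := Topological.on weak_star.

Definition adjoint (T : bop X) (f : dual) : dual := blin_comp f T.

Definition tensor (x : X) (alpha : dual) (T : bop X) : K := alpha (T x).

Lemma tensor_scalar x alpha : scalar (tensor x alpha).
Proof. by move=> c S T; rewrite /tensor blinDE blinZE linearP. Qed.

HB.instance Definition _ x alpha :=
  GRing.isLinear.Build K (bop X) K *%R (tensor x alpha)
    (@tensor_scalar x alpha).

Lemma tensor1 x alpha : tensor x alpha 1 = alpha x. Proof. by []. Qed.

End Dual.

(* Main.v *)
Require Import Defs.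
From HB Require Import structures.
From mathcomp Require Import all_boot all_order all_algebra.
From mathcomp Require Import complex.
From mathcomp Require Import all_classical all_reals all_analysis.
From mathcomp Require Import ring lra.

Set Implicit Arguments.
Unset Strict Implicit.
Unset Printing Implicit Defensive.

Import Order.TTheory GRing.Theory Num.Theory.
Import numFieldNormedType.Exports.
Local Open Scope classical_set_scope.
Local Open Scope ring_scope.

(** Write phi for the functional T |-> alpha (T x).

  Sufficiency.  Suppose that a tracial algebra C contains A, and let c be in
  C and a, b, d in A.  Moving b around by traciality, and using that A is
  commutative, gives phi (b c a d) = phi (c a d b) = phi (c d b a) =
  phi (b a c d), that is, alpha (b (ca - ac) d x) = 0.  Letting b run over A,
  weak* density of the functionals alpha o b gives (ca - ac) d x = 0, since
  the dual separates the points of X; letting d run over A, norm density of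
  the vectors d x gives ca = ac.  So c commutes with A, and a maximal abelian
  subalgebra is its own commutant ([maximal_abelian_commutant]).

  Necessity.  Let J be a subalgebra of B(X), stable under multiplication by A
  on both sides, on which phi vanishes.  Then A + J is tracial, hence J lies
  in A when A is maximal tracial ([maximal_tracial_absorbs]).  If A x is not
  dense, take for J the operators that vanish on A x; if the alpha o a are not
  weak* dense, they all vanish at some z <> 0, and take for J the operators
  whose range is killed by all the alpha o a.  In both cases the theorem of
  Hahn and Banach puts into J two rank one operators that do not commute,
  whereas A is abelian ([maximal_tracial_cyclic] and
  [maximal_tracial_separating]).

  What remains is functional analysis over the real or the complex field: a
  point outside the closure of a subspace is separated from it by a bounded
  functional ([hahn_banach_separation]), and a space of functionals with no
  common zero but 0 is weak* dense ([weak_star_dense]). *)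

(** * Sublinear functionals and the theorem of Hahn and Banach *)

Section Sublinear.
Variables (R : realType) (V : lmodType R).
Implicit Types (p q : V -> R) (u v w : V) (r : R).

(** Positive homogeneity is required in the form of an inequality only, which
  passes to infima more easily; equality follows ([sublinearZ]). *)
Definition sublinear p :=
  (forall u v, p (u + v) <= p u + p v) /\
  (forall r v, 0 <= r -> p (r *: v) <= r * p v).

Lemma sublinear0 p : sublinear p -> p 0 = 0.
Proof.
move=> [pD pZ]; have := pD 0 0; have := pZ 0 0 (lexx _).
rewrite scale0r addr0; lra.
Qed.

Lemma sublinearZ p r v : sublinear p -> 0 <= r -> p (r *: v) = r * p v.
Proof.
move=> psub; rewrite le_eqVlt => /predU1P[<-|r0].
  by rewrite scale0r mul0r sublinear0.
apply/le_anti; rewrite (psub.2 _ _ (ltW r0))/= -ler_pdivlMl//.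
have := psub.2 r^-1 (r *: v).
by rewrite scalerA mulVf ?gt_eqF// scale1r; apply; rewrite invr_ge0 ltW.
Qed.

Lemma sublinear_geN p v : sublinear p -> - p (- v) <= p v.
Proof.
move=> psub; have := psub.1 v (- v); rewrite subrr (sublinear0 psub); lra.
Qed.

Definition lower_envelope (I : Type) (F : I -> V -> R) v :=
  inf (range (F^~ v)).

Section LowerEnvelope.
Variables (I : Type) (F : I -> V -> R) (i0 : I) (b : V -> R).
Hypothesis Fb : forall i v, b v <= F i v.

Lemma lower_envelope_le i v : lower_envelope F v <= F i v.
Proof.
apply: ge_inf; last by exists i.
by exists (b v) => _ [j _ <-]; exact: Fb.
Qed.

Lemma le_lower_envelope r v :
  (forall i, r <= F i v) -> r <= lower_envelope F v.
Proof.
move=> rF; apply: lb_le_inf; first by exists (F i0 v), i0.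
by move=> _ [i _ <-]; exact: rF.
Qed.

(** The common source of the three sublinear functionals needed: the infimum of
  a chain, the envelope along a ray and the distance to a subspace.  The
  family only has to be subadditive and homogeneous up to a change of
  index. *)
Lemma lower_envelope_sublinear :
  (forall i j u v, exists k, F k (u + v) <= F i u + F j v) ->
  (forall i r v, 0 <= r -> exists k, F k (r *: v) <= r * F i v) ->
  sublinear (lower_envelope F).
Proof.
move=> FD FZ; split=> [u v|r v].
  rewrite -lerBlDr; apply: le_lower_envelope => i.
  rewrite lerBlDr -lerBlDl; apply: le_lower_envelope => j.
  rewrite lerBlDl; have [k] := FD i j u v.
  exact/le_trans/lower_envelope_le.
rewrite le_eqVlt => /predU1P[<-|r0].
  have [k] := FZ i0 0 v (lexx _); rewrite !mul0r.
  exact/le_trans/lower_envelope_le.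
rewrite -ler_pdivrMl//; apply: le_lower_envelope => i.
rewrite ler_pdivrMl//; have [k] := FZ i r v (ltW r0).
exact/le_trans/lower_envelope_le.
Qed.

End LowerEnvelope.

Definition nonneg := {t : R | 0 <= t}.
Definition ray_shift p w (t : nonneg) v := p (v + sval t *: w) - sval t * p w.

(** The largest sublinear functional below [p] that is additive along [w] and
  keeps the value of [p] at [w]. *)
Definition ray_envelope p w := lower_envelope (ray_shift p w).

Section RayEnvelope.
Variables (p : V -> R) (w : V).
Hypothesis psub : sublinear p.

Lemma ray_shift_ge t v : - p (- v) <= ray_shift p w t v.
Proof.
case: t => t t0; rewrite /ray_shift/= -(sublinearZ w psub t0).
have := psub.1 (v + t *: w) (- v).
rewrite addrAC subrr add0r; lra.
Qed.

Lemma ray_envelope_le_shift t v : ray_envelope p w v <= ray_shift p w t v.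
Proof. exact: lower_envelope_le ray_shift_ge t v. Qed.

Let zero : nonneg := exist _ 0 (lexx _).
Let one : nonneg := exist _ 1 ler01.

Lemma ray_envelope_sublinear : sublinear (ray_envelope p w).
Proof.
case: psub => pD pZ; apply: (lower_envelope_sublinear zero ray_shift_ge).
  move=> [s s0] [t t0] u v; exists (exist _ (s + t) (addr_ge0 s0 t0)).
  rewrite /ray_shift/= scalerDl addrACA.
  have := pD (u + s *: w) (v + t *: w); lra.
move=> [s s0] r v r0; exists (exist _ (r * s) (mulr_ge0 r0 s0)).
rewrite /ray_shift/= -scalerA -scalerDr.
have := pZ r (v + s *: w) r0; lra.
Qed.

Lemma ray_envelope_le v : ray_envelope p w v <= p v.
Proof.
have := ray_envelope_le_shift zero v.
by rewrite /ray_shift/= scale0r addr0 mul0r subr0.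
Qed.

Lemma ray_envelopeD v : ray_envelope p w v <= p (v + w) - p w.
Proof.
have := ray_envelope_le_shift one v.
by rewrite /ray_shift/= scale1r mul1r.
Qed.

End RayEnvelope.

(** Zorn's lemma applies because sublinearity bounds every [q <= p] below by
  the function [- p (- v)], so that chains have a finite infimum. *)
Lemma minimal_sublinear p : sublinear p ->
  exists q, [/\ sublinear q, forall v, q v <= p v &
    forall q', sublinear q' -> (forall v, q' v <= q v) -> q' = q].
Proof.
move=> psub.
pose below q := sublinear q /\ forall v, q v <= p v.
pose T := {q | below q}.
(* The order is reversed: the lemma of Zorn yields maximal elements. *)
pose le (s t : T) := `[< forall v, sval t v <= sval s v >].
have [|r s t /asboolP rs /asboolP st|s t /asboolP st /asboolP ts|C Ctot|] :=
  @Zorn T le.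
- by move=> t; apply/asboolP.
- by apply/asboolP => v; exact: le_trans (st v) (rs v).
- case: s t st ts => [s sP] [t tP] /= st ts.
  by apply: eq_exist; apply/funext => v; apply/le_anti; rewrite st ts.
- have [->|/set0P[q0 Cq0]] := eqVneq C set0.
    by exists (exist below p (conj psub (fun=> lexx _))).
  pose F (i : {q | C q}) := sval (sval i).
  have Fb i v : - p (- v) <= F i v.
    case: i => -[q [qsub qp]] /= ?; rewrite /F/=.
    by apply: le_trans (sublinear_geN _ qsub); rewrite lerN2.
  have Fsub : sublinear (lower_envelope F).
    apply: (lower_envelope_sublinear (exist _ q0 Cq0) Fb).
      move=> [i Ci] [j Cj] u v; rewrite /F/=.
      have [/asboolP ij|/asboolP ji] := Ctot _ _ Ci Cj.
        exists (exist _ j Cj) => /=; case: (svalP j).1 => + _.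
        by move=> /(_ u v) /le_trans; apply; rewrite lerD2r.
      exists (exist _ i Ci) => /=; case: (svalP i).1 => + _.
      by move=> /(_ u v) /le_trans; apply; rewrite lerD2l.
    move=> i r v r0; exists i.
    exact: (svalP (sval i)).1.2.
  have Fp v : lower_envelope F v <= p v.
    apply: le_trans (lower_envelope_le Fb (exist _ q0 Cq0) v) _.
    exact: (svalP q0).2.
  exists (exist below _ (conj Fsub Fp)) => s Cs; apply/asboolP => v /=.
  exact: (lower_envelope_le Fb (exist _ s Cs) v).
- move=> [q [qsub qp]] qmin; exists q; split=> // q' q'sub q'q.
  have q'p v : q' v <= p v by exact: le_trans (q'q v) (qp v).
  suff /(congr1 sval) : exist below q' (conj q'sub q'p) =
    exist below q (conj qsub qp) by [].
  by apply: qmin; apply/asboolP.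
Qed.

(** By minimality [q] is equal to each of its envelopes along rays, and this
  gives the superadditivity that it lacks. *)
Lemma minimal_sublinear_linear q : sublinear q ->
  (forall q', sublinear q' -> (forall v, q' v <= q v) -> q' = q) ->
  forall r u v, q (r *: u + v) = r * q u + q v.
Proof.
move=> qsub qmin; case: (qsub) => qD qZ.
have flat w v : q v <= q (v + w) - q w.
  rewrite -{1}(qmin _ (ray_envelope_sublinear w qsub) (ray_envelope_le w qsub)).
  exact: ray_envelopeD.
have qDE u v : q (u + v) = q u + q v.
  by have := qD u v; have := flat v u; lra.
have qN v : q (- v) = - q v.
  by have := qDE v (- v); rewrite subrr (sublinear0 qsub); lra.
have qZge0 r v : 0 <= r -> q (r *: v) = r * q v.
  move=> r0; have := qZ r v r0; have := qZ r (- v) r0.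
  rewrite scalerN !qN; lra.
move=> r u v; rewrite qDE; congr (_ + _).
have [/qZge0//|r0] := leP 0 r.
by rewrite -[r]opprK scaleNr qN qZge0 ?mulNr// oppr_ge0 ltW.
Qed.

(** Passing to the envelope of [p] along [v0] before minimizing forces
  [f (- v0) <= - p v0], whence [f v0 = p v0]. *)
Theorem hahn_banach p v0 : sublinear p ->
  exists f : V -> R, [/\ forall r u v, f (r *: u + v) = r * f u + f v,
    forall v, f v <= p v & f v0 = p v0].
Proof.
move=> psub; have psub' := ray_envelope_sublinear v0 psub.
have [f [fsub fp fmin]] := minimal_sublinear psub'.
have flin := minimal_sublinear_linear fsub fmin.
have fp' v : f v <= p v by exact: le_trans (fp v) (ray_envelope_le _ _ _).
exists f; split=> //; apply/le_anti; rewrite fp'/=.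
have := fp (- v0); have := ray_envelopeD v0 psub (- v0).
rewrite addNr (sublinear0 psub).
have := flin (-1) v0 0; rewrite addr0 scaleN1r (sublinear0 fsub); lra.
Qed.

End Sublinear.

(** * Separating a point from a closed subspace *)

Definition subspace_set (K : numFieldType) (V : lmodType K) (S : set V) :=
  S 0 /\ forall c u v, S u -> S v -> S (c *: u + v).

Lemma subspace_setZ (K : numFieldType) (V : lmodType K) (S : set V) c u :
  subspace_set S -> S u -> S (c *: u).
Proof. by move=> [S0 SD] Su; rewrite -[_ *: _]addr0; exact: SD. Qed.

Lemma subspace_setD (K : numFieldType) (V : lmodType K) (S : set V) u v :
  subspace_set S -> S u -> S v -> S (u + v).
Proof. by move=> [S0 SD] Su Sv; rewrite -[u]scale1r; exact: SD. Qed.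

(** The distance to [S] is sublinear, at most [N], zero on [S] and at least
  [e] at [v0]: a linear functional below it that agrees with it at [v0] does
  the job. *)
Lemma seminorm_separation (R : realType) (V : lmodType R) (N : V -> R)
    (S : set V) (v0 : V) (e : R) :
  (forall u v, N (u + v) <= N u + N v) ->
  (forall r v, N (r *: v) = `|r| * N v) ->
  subspace_set S -> 0 < e -> (forall s, S s -> e <= N (v0 + s)) ->
  exists f : V -> R, [/\ forall r u v, f (r *: u + v) = r * f u + f v,
    forall s, S s -> f s = 0, f v0 != 0 & forall v, `|f v| <= N v].
Proof.
move=> ND NZ Ssub e0 Nv0; have [S0 _] := Ssub.
have N0 : N 0 = 0 by rewrite -(scale0r 0) NZ normr0 mul0r.
have NN v : N (- v) = N v by rewrite -scaleN1r NZ normrN1 mul1r.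
have Nge0 v : 0 <= N v.
  by have := ND v (- v); rewrite subrr N0 NN; lra.
pose F (i : {s | S s}) v := N (v + sval i).
have F0 i v : 0 <= F i v by exact: Nge0.
have psub : sublinear (lower_envelope F).
  apply: (lower_envelope_sublinear (exist _ 0 S0) F0).
    move=> [s Ss] [t St] u v.
    exists (exist _ (s + t) (subspace_setD Ssub Ss St)).
    by rewrite /F/= addrACA ND.
  move=> [s Ss] r v r0; exists (exist _ (r *: s) (subspace_setZ r Ssub Ss)).
  by rewrite /F/= -scalerDr NZ ger0_norm.
have [f [flin fp fv0]] := hahn_banach v0 psub.
have f0 : f 0 = 0 by have := flin 1 0 0; rewrite scale1r addr0; lra.
have fN v : f (- v) = - f v.
  by have := flin (-1) v 0; rewrite addr0 scaleN1r f0; lra.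
have fF v s : S s -> f v <= N (v + s).
  move=> Ss; apply: le_trans (fp v) _.
  exact: (lower_envelope_le F0 (exist _ s Ss)).
have fle0 s : S s -> f s <= 0.
  move=> Ss; have := fF s (- s); rewrite subrr N0 -scaleN1r; apply.
  exact: subspace_setZ.
exists f; split=> // [s Ss||v].
- apply/le_anti; rewrite fle0//= -oppr_le0 -fN fle0// -scaleN1r.
  exact: subspace_setZ.
- apply/lt0r_neq0/(lt_le_trans e0); rewrite fv0.
  by apply: (le_lower_envelope (exist _ 0 S0)) => -[s Ss]; exact: Nv0.
- have := fF v 0 S0; have := fF (- v) 0 S0.
  by rewrite !addr0 fN NN => ? ?; rewrite ler_norml; lra.
Qed.

Section Complex.
Local Open Scope complex_scope.

Section Realification.
Variables (R : realType) (V : lmodType R[i]).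

(** The underlying real vector space of a complex one; an alias is needed to
  carry the second scalar action. *)
Definition realification : Type := V.
HB.instance Definition _ := GRing.Zmodule.on realification.

Let scale (r : R) (v : realification) : realification := r%:C *: (v : V).
Let scaleA r s v : scale r (scale s v) = scale (r * s) v.
Proof. by rewrite /scale scalerA rmorphM. Qed.
Let scale1 : left_id 1 scale.
Proof. by move=> v; rewrite /scale rmorph1 scale1r. Qed.
Let scaleDr : right_distributive scale +%R.
Proof. by move=> r u v; exact: scalerDr. Qed.
Let scaleDl v : {morph scale^~ v : r s / r + s}.
Proof. by move=> r s; rewrite /scale rmorphD; exact: scalerDl. Qed.

HB.instance Definition _ := GRing.Zmodule_isLmodule.Build R realification
  scaleA scale1 scaleDr scaleDl.

Lemma realificationZE r (v : realification) : r *: v = r%:C *: (v : V) :> V.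
Proof. by []. Qed.

End Realification.

Lemma not_closure_ball (K : numFieldType) (X : normedModType K)
    (S : set X) (v : X) : subspace_set S -> ~ closure S v ->
  exists2 e : K, 0 < e & forall s, S s -> e <= `|v + s|.
Proof.
move=> Ssub nSv; apply: contrapT => nex; apply: nSv => B.
move=> /nbhs_ballP[e /= e0 vB]; apply: contrapT => SB0; apply: nex.
exists e => // s Ss; rewrite (real_leNgt (gtr0_real e0) (normr_real _)).
apply/negP => lt_vs_e; apply: SB0; exists (- s).
split; first by rewrite -scaleN1r; exact: subspace_setZ.
by apply: vB; rewrite -ball_normE/= opprK.
Qed.

Lemma real_separation (R : realType) (X : normedModType R)
    (S : set X) (v : X) : subspace_set S -> ~ closure S v ->
  exists f : dual X, (forall s, S s -> f s = 0) /\ f v != 0.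
Proof.
move=> Ssub /(not_closure_ball Ssub)[e e0 Sv].
have [f [flin fS fv fN]] := seminorm_separation (@ler_normD _ X)
  (@normrZ _ X) Ssub e0 Sv.
have fb : (f : X -> R^o) \in @bounded_linear_map R X R^o.
  by apply/asboolP; split=> //; exists 1 => u; rewrite mul1r fN.
by exists (BLin fb).
Qed.

(** A real functional [f] is the real part of the complex functional
  [u |-> f u - i f (i u)], which vanishes wherever [f] does on a complex
  subspace. *)
Lemma complex_separation (R : realType) (X : normedModType R[i])
    (S : set X) (v : X) : subspace_set S -> ~ closure S v ->
  exists f : dual X, (forall s, S s -> f s = 0) /\ f v != 0.
Proof.
move=> Ssub /(not_closure_ball Ssub)[e e0 Sv].
pose N (u : realification X) : R := complex.Re `|u : X|.
have NE u : (N u)%:C = `|u : X| by rewrite RRe_real.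
have ND u w : N (u + w) <= N u + N w.
  by rewrite -lecR rmorphD/= !NE ler_normD.
have NZ r u : N (r *: u) = `|r| * N u.
  apply: complexI; rewrite rmorphM/= !NE realificationZE normrZ.
  by congr (_ * _); rewrite normc_def/= expr0n/= addr0 sqrtr_sqr.
have Rsub : subspace_set (S : set (realification X)).
  by split=> [|r u w Su Sw]; [exact: Ssub.1|exact: Ssub.2].
have Re0 : 0 < complex.Re e by move: e0; rewrite ltcE => /andP[].
have ReE : (complex.Re e)%:C = e by rewrite RRe_real ?gtr0_real.
have RSv s : S s -> complex.Re e <= N ((v : realification X) + s).
  by move=> /Sv; rewrite -lecR NE ReE.
have [f [flin fS fv fN]] := seminorm_separation ND NZ Rsub Re0 RSv.
pose g (u : X) : R[i] := (f u)%:C - 'i%C * (f ('i%C *: u))%:C.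
have f0 : f 0 = 0 by have := flin 1 0 0; rewrite scale1r addr0; lra.
have fD u w : f (u + w) = f u + f w.
  by have := flin 1 u w; rewrite scale1r mul1r.
have fZ r (u : X) : f (r%:C *: u) = r * f u.
  by have := flin r u 0; rewrite f0 !addr0.
have fc a b (u : X) : f ((a +i* b)%C *: u) = a * f u + b * f ('i%C *: u).
  rewrite [X in X *: _]complexE/= scalerDl fD fZ; congr (_ + _).
  by rewrite mulrC -scalerA fZ.
have fic a b (u : X) :
    f ('i%C *: ((a +i* b)%C *: u)) = a * f ('i%C *: u) - b * f u.
  rewrite scalerA (_ : _ * _ = (- b +i* a)%C); last by simpc.
  by rewrite (fc (- b) a u) mulNr addrC.
have fN1 u : f (- u) = - f u.
  by have := flin (-1) u 0; rewrite addr0 scaleN1r f0; lra.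
have gb : (g : X -> R[i]^o) \in @bounded_linear_map R[i] X R[i]^o.
  apply/asboolP; split.
    move=> [a b] u w; rewrite /g scalerDr !fD (fc a b u) (fic a b u).
    apply/eqP; rewrite eq_complex/=.
    by apply/andP; split; apply/eqP => /=; ring.
  (* The bound 2 comes from |f u| <= |u| and |f (i u)| <= |i u| = |u|. *)
  exists 2 => u; rewrite /g mulr2n mulrDl mul1r.
  rewrite (le_trans (ler_normB _ _))//.
  have fNC w : `|(f w)%:C| <= `|w : X|.
    by rewrite -NE normc_def/= expr0n/= addr0 sqrtr_sqr lecR fN.
  rewrite lerD// normrM.
  have ni : `|'i%C : R[i]| = 1.
    by rewrite normc_def/= expr0n/= add0r expr1n sqrtr1.
  by rewrite ni mul1r (le_trans (fNC _))// normrZ ni mul1r.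
exists (BLin gb); split=> [s Ss|] /=.
  rewrite /g !fS ?rmorph0 ?mulr0 ?subr0//; exact: subspace_setZ.
apply: contra_neq fv => /(congr1 (@complex.Re R)).
rewrite /g/= => h; lra.
Qed.

End Complex.

Theorem hahn_banach_separation (R : realType) (k : scalar_kind)
    (X : normedModType (scalar_field R k)) (S : set X) (v : X) :
  subspace_set S -> ~ closure S v ->
  exists f : dual X, (forall s, S s -> f s = 0) /\ f v != 0.
Proof.
by case: k X S v; [exact: real_separation|exact: complex_separation].
Qed.

(** * Weak* density of separating spaces of functionals *)

Section WeakStar.
Variables (K : numFieldType) (X : normedModType K).
Implicit Types (W : set (dual X)) (f w : dual X) (z : X).

Definition preannihilator W : set X := [set z | forall w, W w -> w z = 0].

(** Induction on the number of points.  If some [w0] in [W] has [w0 y = 1],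
  the remaining points are handled in the subspace of those [w] in [W] that
  vanish at [y], applied to [f - f y w0]: if all these [w] vanish at [z], then
  all of [W] vanishes at [z - w0 z y]. *)
Lemma interpolation W f (s : seq X) : subspace_set W ->
  preannihilator W `<=` [set z | f z = 0] ->
  exists2 w, W w & forall z, z \in s -> w z = f z.
Proof.
elim: s W f => [|y s IHs] W f [W0 WD] Wf; first by exists 0.
have [Wy|] := pselect (preannihilator W y).
  have [w Ww wf] := IHs W f (conj W0 WD) Wf.
  exists w => // z; rewrite inE => /predU1P[->|/wf//].
  by rewrite Wy// Wf.
move=> /existsNP[w1 /not_implyP[Ww1 /eqP w1y]].
have [w0 Ww0 w0y] : exists2 w0 : dual X, W w0 & w0 y = 1.
  exists ((w1 y)^-1 *: w1); first exact: (subspace_setZ _ (conj W0 WD)).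
  by rewrite blinZE; exact: mulVf.
pose W' : set (dual X) := [set w | W w /\ w y = 0].
have W'sub : subspace_set W'.
  split=> [|c u v [Wu uy] [Wv vy]]; first by split.
  by split; [exact: WD|rewrite blinDE blinZE uy vy scaler0 addr0].
have W'f : preannihilator W' `<=` [set z | (f - f y *: w0) z = 0].
  move=> z W'z; rewrite -[_ z]/((f - f y *: w0) z = 0).
  rewrite -scaleNr addrC blinDE blinZE.
  have subE (g : dual X) : g (z - w0 z *: y) = g z - w0 z * g y.
    by rewrite linearB linearZ.
  suff /Wf : preannihilator W (z - w0 z *: y).
    by rewrite /= subE => fz; rewrite /GRing.scale/= mulNr (mulrC (f y)) addrC.
  move=> w Ww; rewrite subE.
  have : (- w y *: w0 + w) z = 0.
    apply: W'z; split; first exact: WD.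
    by rewrite blinDE blinZE w0y /GRing.scale/= mulr1 addNr.
  by rewrite blinDE blinZE /GRing.scale/= mulNr addrC mulrC.
have [w [Ww wy] wf] := IHs W' _ W'sub W'f.
exists (f y *: w0 + w); first exact: WD.
move=> z; rewrite inE => /predU1P[->|/wf zf]; rewrite blinDE blinZE.
  by rewrite w0y wy addr0 /GRing.scale/= mulr1.
by rewrite zf blinDE -scaleNr blinZE scaleNr addrCA subrr addr0.
Qed.

Lemma eval_weak_star_continuous z :
  continuous (fun f : weak_star X => (f : dual X) z : K^o).
Proof.
move=> f.
apply: (@continuous_comp (weak_star X) {ptws X -> K^o} K^o
  (fun f : dual X => (f : X -> K^o)) (fun g => g z)).
  exact: initial_continuous.
exact: (@proj_continuous X (fun=> K^o) z).
Qed.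

(** The functionals that agree with [f] on finitely many points generate a
  filter that converges pointwise to [f], hence for the weak* topology. *)
Lemma weak_star_nbhs_finite f (B : set (weak_star X)) :
  nbhs (f : weak_star X) B ->
  exists s : seq X, forall g : dual X, (forall z, z \in s -> g z = f z) -> B g.
Proof.
rewrite nbhsE => -[_ [[U Uop <-] Uf] UB].
pose agree (s : seq X) : set (X -> K^o) :=
  [set g | forall z, z \in s -> g z = f z].
pose F := filter_from setT agree.
have FF : Filter F.
  apply: filter_from_filter; first by exists [::].
  move=> s t _ _; exists (s ++ t) => // g gst.
  by split=> z zs; apply: gst; rewrite mem_cat zs ?orbT.
have Ff : {ptws, F --> (f : X -> K^o)}.
  apply/pointwise_cvgP => z A /nbhs_singleton Afz.
  by exists [:: z] => // g gz; rewrite /= gz// mem_head.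
have [s _ sU] : F U by apply: Ff; exact: open_nbhs_nbhs.
by exists s => g gf; apply: UB; exact: sU.
Qed.

Lemma weak_star_dense W : subspace_set W ->
  preannihilator W `<=` [set 0] ->
  closure (W : set (weak_star X)) = [set: weak_star X].
Proof.
move=> Wsub W0; apply/seteqP; split=> // f _ B /weak_star_nbhs_finite[s sB].
have [|w Ww wf] := @interpolation W f s Wsub.
  by move=> z /W0 ->; exact: linear0.
by exists w; split=> //; exact: sB.
Qed.

Lemma preannihilator_closure W z : preannihilator W z ->
  closure (W : set (weak_star X)) `<=` [set f | (f : dual X) z = 0].
Proof.
move=> Wz.
have cl0 : closed [set f : weak_star X | (f : dual X) z = 0].
  apply: (@preimage_closed _ _ _ [set 0 : K^o]).
    by move=> f _; exact: eval_weak_star_continuous.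
  exact/accessible_closed_set1/hausdorff_accessible/norm_hausdorff.
have /closure_id -> := cl0; exact: closure_subset.
Qed.

End WeakStar.

Lemma blin_continuous (K : numFieldType) (V W : normedModType K)
  (f : blin V W) : continuous f.
Proof.
apply/linear_bounded_continuous/linear_boundedP.
have [M fM] := blin_bounded f.
exists `|M|; split=> [|r Mr v]; first exact: normr_real.
have [->|v0] := eqVneq v 0; first by rewrite linear0 !normr0 mulr0.
have M0 : 0 <= M.
  by have := le_trans (normr_ge0 _) (fM v); rewrite pmulr_lge0 ?normr_gt0.
rewrite (le_trans (fM v))// ler_wpM2r// (le_trans _ (ltW Mr))//.
by rewrite ger0_norm.
Qed.

(** * Maximal abelian and maximal tracial subalgebras *)

Lemma rank_one_bounded (K : numFieldType) (X : normedModType K)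
    (y : X) (f : dual X) :
  (fun v => (f v : K) *: y) \in @bounded_linear_map K X X.
Proof.
have [M fM] := blin_bounded f; apply/asboolP; split=> [c u v|].
  by rewrite linearP scalerDl scalerA.
exists (M * `|y|) => v; rewrite normrZ mulrAC ler_wpM2r//; exact: fM.
Qed.

Definition rank_one (K : numFieldType) (X : normedModType K) (y : X)
  (f : dual X) : bop X := BLin (rank_one_bounded y f).

Section Algebra.
Variables (K : numFieldType) (X : normedModType K).
Implicit Types (A C J S : set (bop X)) (phi : {scalar bop X}).

Definition commutant S : set (bop X) :=
  [set T | forall U, S U -> T * U = U * T].

Lemma commutant_subalgebra S : subalgebra (commutant S).
Proof.
split=> [U _|a b Sa Sb U SU|c a Sa U SU|a b Sa Sb U SU].
- by rewrite mul0r mulr0.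
- by rewrite mulrDl mulrDr Sa// Sb.
- by rewrite -bop_scalerAl -bop_scalerAr Sa.
- by rewrite -mulrA Sb// mulrA Sa// mulrA.
Qed.

Lemma bicommutant_abelian S :
  S `<=` commutant S -> abelian_subalgebra (commutant (commutant S)).
Proof.
move=> SS; split; first exact: commutant_subalgebra.
by move=> a b Sa Sb; apply: Sa => U SU; apply: Sb; exact: SS.
Qed.

(** If [c] commutes with [A], the bicommutant of [A] and [c] is an abelian
  subalgebra that contains both, so it is [A]. *)
Lemma maximal_abelian_commutant A c :
  maximal_abelian A -> commutant A c -> A c.
Proof.
move=> [[_ Aab] Amax] Ac.
pose S := A `|` [set c].
have SS : S `<=` commutant S.
  move=> a [Aa|->] b [Ab|->]//; [exact: Aab|exact/esym/Ac|exact: Ac].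
have SS'' : S `<=` commutant (commutant S).
  by move=> a Sa b Sb; rewrite (Sb a).
rewrite -(Amax _ (bicommutant_abelian SS)); first by apply: SS''; right.
by move=> a Aa; apply: SS''; left.
Qed.

Lemma maximal_abelian1 A : maximal_abelian A -> A 1.
Proof.
by move=> /maximal_abelian_commutant; apply=> U _; rewrite mul1r mulr1.
Qed.

(** The sum [A + J] is again tracial: in the product of [a + j] and [b + i]
  every term but [a * b] lies in [J], where [phi] vanishes. *)
Lemma maximal_tracial_absorbs phi A J :
  maximal_tracial phi A -> subalgebra J ->
  (forall a j, A a -> J j -> J (a * j) /\ J (j * a)) ->
  (forall j, J j -> phi j = 0) -> J `<=` A.
Proof.
move=> [[[A0 AD AZ AM] A1 Atr] Amax] [J0 JD JZ JM] AJ phiJ.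
pose C : set (bop X) := [set T | exists a j, [/\ A a, J j & T = a + j]].
have AC : A `<=` C by move=> a Aa; exists a, 0; rewrite addr0.
suff Ctr : tracial phi C.
  by rewrite -(Amax C Ctr AC) => j Jj; exists 0, j; rewrite add0r; split.
split=> [||_ _ [a [j [Aa Jj ->]]] [b [i [Ab Ji ->]]]]; last first.
- have [Jaj Jja] := AJ _ _ Aa Ji; have [Jbj Jjb] := AJ _ _ Ab Jj.
  rewrite !mulrDl !mulrDr !linearD/= (Atr a b)//.
  by rewrite !(phiJ (a * i), phiJ (j * b), phiJ (b * j), phiJ (i * a))//
    !(phiJ (j * i), phiJ (i * j))//; exact: JM.
- exact: AC.
split; first exact: AC.
- move=> _ _ [a [j [Aa Jj ->]]] [b [i [Ab Ji ->]]].
  by exists (a + b), (j + i); rewrite addrACA; split; [exact: AD|exact: JD|].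
- move=> c _ [a [j [Aa Jj ->]]].
  by exists (c *: a), (c *: j); rewrite scalerDr; split; [exact: AZ|exact: JZ|].
- move=> _ _ [a [j [Aa Jj ->]]] [b [i [Ab Ji ->]]].
  have [Jai _] := AJ _ _ Aa Ji; have [_ Jjb] := AJ _ _ Ab Jj.
  exists (a * b), (a * i + (j * b + j * i)).
  rewrite mulrDl !mulrDr -!addrA; split=> //; first exact: AM.
  by apply: (JD _ _ Jai); apply: (JD _ _ Jjb); exact: JM.
Qed.

Lemma orbit_subspace A x : subalgebra A -> subspace_set [set T x | T in A].
Proof.
move=> [A0 AD AZ _]; split; first by exists 0.
move=> c _ _ [a Aa <-] [b Ab <-]; exists (c *: a + b) => //.
by apply: AD => //; exact: AZ.
Qed.

Lemma adjoint_orbit_subspace A (alpha : dual X) :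
  subalgebra A -> subspace_set [set adjoint T alpha | T in A].
Proof.
move=> [A0 AD AZ _]; split.
  by exists 0 => //; apply: blinP => v; exact: linear0.
move=> c _ _ [a Aa <-] [b Ab <-]; exists (c *: a + b).
  by apply: AD => //; exact: AZ.
by apply: blinP => v; exact: linearP.
Qed.

(** For every [y] the operator [y (x) f] vanishes on the orbit of [x], so it
  belongs to [A].  As [f x = 0], comparing the two products of [x (x) f] and
  [z (x) f] at [z] gives [(f z)^2 x = 0]. *)
Lemma maximal_tracial_cyclic A x (alpha f : dual X) :
  abelian_subalgebra A -> maximal_tracial (tensor x alpha) A ->
  alpha x = 1 -> (forall a, A a -> f (a x) = 0) -> f = 0.
Proof.
move=> [Asub Aab] Amax alphax fA.
have A1 : A 1 by case: Amax => -[].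
pose J : set (bop X) := [set T | forall a, A a -> T (a x) = 0].
have [A0 AD AZ AM] := Asub.
have JA : J `<=` A.
  apply: maximal_tracial_absorbs Amax _ _ _.
  - split=> [//|S T JS JT a Aa|c T JT a Aa|S T JS JT a Aa].
    + by rewrite blinDE JS// JT// addr0.
    + by rewrite blinZE JT// scaler0.
    + by rewrite bopME JT// linear0.
  - move=> a T Aa JT; split=> b Ab; first by rewrite bopME JT// linear0.
    exact: (JT (a * b) (AM _ _ Aa Ab)).
  - by move=> T /(_ 1 A1); rewrite bop1E /= /tensor => ->; exact: linear0.
have J1 y : J (rank_one y f) by move=> a Aa; rewrite /= fA// scale0r.
have fx : f x = 0 by exact: fA A1.
apply: blinP => z.
have /(congr1 (fun T : bop X => T z)) := Aab _ _ (JA _ (J1 x)) (JA _ (J1 z)).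
rewrite !bopME/= !linearZ/= fx scaler0 scale0r.
move/(congr1 alpha); rewrite linear0 !linearZ/= alphax.
by move/eqP; rewrite /GRing.scale/= mulr1 mulf_eq0 orbb => /eqP.
Qed.

(** For every [g] the range of [z (x) g] is killed by all the [alpha o a], so
  [z (x) g] belongs to [A].  As [alpha z = 0], comparing the two products of
  [z (x) f] and [z (x) alpha] at [x], then applying [f], gives
  [(f z)^2 = 0]. *)
Lemma maximal_tracial_separating A x (alpha f : dual X) (z : X) :
  abelian_subalgebra A -> maximal_tracial (tensor x alpha) A ->
  alpha x = 1 -> (forall a, A a -> alpha (a z) = 0) -> f z = 0.
Proof.
move=> [Asub Aab] Amax alphax Az.
have A1 : A 1 by case: Amax => -[].
pose J : set (bop X) := [set T | forall a v, A a -> alpha (a (T v)) = 0].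
have [A0 AD AZ AM] := Asub.
have JA : J `<=` A.
  apply: maximal_tracial_absorbs Amax _ _ _.
  - split=> [a v _|S T JS JT a v Aa|c T JT a v Aa|S T JS JT a v Aa].
    + by rewrite (linear0 a) linear0.
    + by rewrite blinDE !linearD/= JS// JT// addr0.
    + by rewrite blinZE !linearZ/= JT// scaler0.
    + by rewrite bopME JS.
  - move=> a T Aa JT; split=> b v Ab; last by rewrite bopME JT.
    exact: (JT (b * a) v (AM _ _ Ab Aa)).
  - by move=> T JT; exact: JT _ x A1.
have J1 g : J (rank_one z g).
  by move=> a v Aa; rewrite /= !linearZ/= Az// scaler0.
have az : alpha z = 0 by exact: Az A1.
have /(congr1 (fun T : bop X => f (T x))) :=
  Aab _ _ (JA _ (J1 f)) (JA _ (J1 alpha)).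
rewrite !bopME/= !linearZ/= alphax az scale1r scaler0 scale0r.
by move/eqP; rewrite mulf_eq0 orbb => /eqP.
Qed.

End Algebra.

Theorem corollary2p6 (R : realType) (k : scalar_kind)
    (X : completeNormedModType (scalar_field R k))
    (x : X) (alpha : dual X) (hx : alpha x = 1)
    (A : set (bop X)) (hA : maximal_abelian A) :
  maximal_tracial (tensor x alpha) A <->
  closure [set T x | T in A] = [set: X] /\
  closure ([set adjoint T alpha | T in A] : set (weak_star X)) =
    [set: weak_star X].
Proof.
have [Asub Aab] := hA.1; have [_ _ _ AM] := Asub.
have A1 := maximal_abelian1 hA.
have orbit_sub := orbit_subspace x Asub.
have adjoint_sub := adjoint_orbit_subspace alpha Asub.
have zero_sub : subspace_set [set 0 : X].
  by split=> // c _ _ -> ->; rewrite scaler0 addr0.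
have separates (z : X) : (forall f : dual X, f z = 0) -> z = 0.
  move=> fz; apply: contrapT => z0.
  have [|f [_ /eqP]] := hahn_banach_separation (v := z) zero_sub.
    have /closure_id <- // : closed [set 0 : X].
    exact/accessible_closed_set1/hausdorff_accessible/norm_hausdorff.
  by apply.
split=> [Amax|[cyclic dual_cyclic]].
  split.
    apply/seteqP; split=> // v _; apply: contrapT => nv.
    have [f [fA]] := hahn_banach_separation orbit_sub nv.
    rewrite (maximal_tracial_cyclic (f := f) hA.1 Amax hx) ?eqxx//.
    by move=> a Aa; apply: fA; exists a.
  apply: weak_star_dense => // z Az; apply: separates => f.
  apply: (maximal_tracial_separating f hA.1 Amax hx) => a Aa.
  by apply: (Az (adjoint a alpha)); exists a.
split; first by split=> // a b Aa Ab; rewrite Aab.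
move=> C [[_ _ _ CM] _ Ctr] AC; apply/seteqP; split=> // c Cc.
apply: (maximal_abelian_commutant hA) => a Aa.
apply/eqP; rewrite -subr_eq0; apply/eqP; set D := _ - _.
have Dx d : A d -> D (d x) = 0.
  move=> Ad; apply: separates => f.
  have : closure ([set adjoint T alpha | T in A] : set (weak_star X)) f.
    by rewrite dual_cyclic.
  apply: preannihilator_closure => _ [b Ab <-].
  have [Ca Cb Cd] := And3 (AC _ Aa) (AC _ Ab) (AC _ Ad).
  (* Traciality turns the two terms of b D d into c a d b and c d b a, which
     are equal because A is commutative. *)
  have e1 : tensor x alpha (b * (c * (a * d))) =
            tensor x alpha (c * (a * d) * b).
    by apply: Ctr => //; apply/CM => //; exact: CM.
  have e2 : tensor x alpha (b * a * (c * d)) =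
            tensor x alpha (c * d * (b * a)).
    by apply: Ctr; exact: CM.
  suff : tensor x alpha (b * (D * d)) = 0 by [].
  have -> : b * (D * d) = b * (c * (a * d)) - b * a * (c * d).
    by rewrite /D mulrBl mulrBr !mulrA.
  rewrite linearB/= e1 e2 -!mulrA (Aab a (d * b))//; last exact: AM.
  by rewrite -!mulrA subrr.
apply: blinP => v.
have clD : closed [set v | D v = 0].
  apply: (@preimage_closed _ _ _ [set 0 : X]).
    by move=> u _; exact: blin_continuous.
  exact/accessible_closed_set1/hausdorff_accessible/norm_hausdorff.
have : closure [set T x | T in A] v by rewrite cyclic.
suff : closure [set T x | T in A] `<=` [set v | D v = 0] by apply.
by have /closure_id -> := clD; apply: closure_subset => _ [d Ad <-]; exact: Dx.
Qed.
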